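(* For every integer $m\ge 1$ there exists an integer $n_0=n_0(m)$ such that the following holds for all integers $k\ge 2$, $t\ge 1$ and $1\le n_1\le n_2\le\cdots\le n_k$, and every non-empty set $R\subseteq[n_1]$ of integers with $\min R\ge t$, $\max R=m$ and $n_2\ge n_0$. Let $\mathscr{F}\subseteq\mathcal{K}_R(n_1,\ldots,n_k)$ be a $t$-intersecting family. Then \[ |\mathscr{F}|\le\sum_{r\in R}\frac{(n_1-t)_{r-t}\cdots(n_k-t)_{r-t}}{(r-t)!}. \] Furthermore, equality is attained if and only if $\mathscr{F}$ is a $t$-star of $\mathcal{K}_R(n_1,\ldots,n_k)$.
   Context: For a positive integer $n$, $[n]=\{1,\ldots,n\}$. For non-negative integers $b\le a$, $(a)_b=\frac{a!}{(a-b)!}$. $\mathcal{K}(n_1,\ldots,n_k)$ denotes the complete $k$-partite $k$-graph with parts $[n_1],\ldots,[n_k]$ (regarded as disjoint); its edges are identified with the $k$-tuples $(x_1,\ldots,x_k)\in[n_1]\times\cdots\times[n_k]$. An $r$-matching is a set of $r$ pairwise vertex-disjoint edges, i.e. a set of $r$ such $k$-tuples any two of which differ in every coordinate. $\mathcal{K}_r(n_1,\ldots,n_k)$ is the set of all $r$-matchings of $\mathcal{K}(n_1,\ldots,n_k)$, and $\mathcal{K}_R(n_1,\ldots,n_k)=\bigcup_{r\in R}\mathcal{K}_r(n_1,\ldots,n_k)$. A family $\mathscr{F}\subseteq\mathcal{K}_R(n_1,\ldots,n_k)$ is $t$-intersecting if any two members of $\mathscr{F}$ share at least $t$ edges. A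 $t$-star of $\mathcal{K}_R(n_1,\ldots,n_k)$ is a family of the form $\{M\in\mathcal{K}_R(n_1,\ldots,n_k): C\subseteq M\}$ for some $t$-matching $C\in\mathcal{K}_t(n_1,\ldots,n_k)$. *)

(* Defs.v *)
From mathcomp Require Import all_boot all_order all_algebra finmap.

Set Implicit Arguments.
Unset Strict Implicit.
Unset Printing Implicit Defensive.

Import GRing.Theory.

Section Matchings.
Variables (k : nat) (n : 'I_k -> nat).

(* The part [n_i] is represented by 'I_(n i), that is, {0, ..., n_i - 1}. *)
Definition edge : finType := {dffun forall i : 'I_k, 'I_(n i)}.

Definition vdisjoint (x y : edge) : bool := [forall i, x i != y i].

Definition is_matching (M : {set edge}) : bool :=
  [forall x in M, forall y in M, (x != y) ==> vdisjoint x y].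

Definition matchings (r : nat) : {set {set edge}} :=
  [set M | is_matching M & #|M| == r].

Definition matchings_in (R : {fset nat}) : {set {set edge}} :=
  \bigcup_(r <- R) matchings r.

(* M and N range over all pairs, including M = N; this adds nothing when every
   member of F has at least t edges. *)
Definition t_intersecting (t : nat) (F : {set {set edge}}) : Prop :=
  forall M N, M \in F -> N \in F -> t <= #|M :&: N|.

Definition t_star (t : nat) (R : {fset nat}) (F : {set {set edge}}) : Prop :=
  exists2 C, C \in matchings t & F = [set M in matchings_in R | C \subset M].

Definition star_size (t : nat) (R : {fset nat}) : rat :=
  (\sum_(r <- R)
     (\prod_(i < k) ((n i - t) ^_ (r - t))%:R) / ((r - t)`!)%:R)%R.

End Matchings.

(* Main.v *)
(** If all members of the family share t edges, the family lies in a t-star.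
    Otherwise fix a member M0: every member contains one of the at most 2^m
    t-subsets C of M0, and since some member N omits part of C, every member
    containing C also contains one of the at most m edges of N outside C.  So
    the family is covered by 2^m * m stars centred at (t+1)-matchings, each
    smaller than a t-star by a factor of at least (n_2 - t) / m. *)

Require Import Defs.
From mathcomp Require Import all_boot all_order all_algebra finmap.

Set Implicit Arguments.
Unset Strict Implicit.
Unset Printing Implicit Defensive.

Import Order.TTheory GRing.Theory Num.Theory.

Lemma leq_card_bigcup (I T : finType) (P : pred I) (A : I -> {set T}) :
  #|\bigcup_(i | P i) A i| <= \sum_(i | P i) #|A i|.
Proof.
elim/big_ind2: _ => [|b B c C leB leC|//]; first by rewrite cards0.
by rewrite (leq_trans (leq_card_setU _ _)) ?leq_add.
Qed.

Section Star.
Variables (k : nat) (n : 'I_k -> nat).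
Hypothesis k_gt0 : 0 < k.
Implicit Types (x y : edge n) (C M N : {set edge n}) (R : {fset nat})
  (F : {set {set edge n}}).

Definition star r C : {set {set edge n}} :=
  [set M in matchings n r | C \subset M].

Definition star_in R C : {set {set edge n}} :=
  [set M in matchings_in n R | C \subset M].

(** For a matching [C] and [0 < k], these are exactly the edges outside [C] whose addition to [C]
    gives a matching. *)
Definition extensions C : {set edge n} :=
  [set x | [forall y in C, vdisjoint x y]].

(** * Matchings and their extensions by one edge *)

Lemma is_matchingP M :
  reflect {in M &, forall x y, x != y -> vdisjoint x y} (is_matching M).
Proof.
apply: (iffP forall_inP) => [mM x y Mx My|mM x Mx].
  by move/forall_inP: (mM x Mx) => /(_ y My) /implyP.
by apply/forall_inP => y My; apply/implyP; apply: mM.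
Qed.

Lemma is_matchingS C M : C \subset M -> is_matching M -> is_matching C.
Proof.
move=> /subsetP sCM /is_matchingP mM; apply/is_matchingP => x y Cx Cy.
by apply: mM; apply: sCM.
Qed.

Lemma vdisjointC x y : vdisjoint x y = vdisjoint y x.
Proof. by apply: eq_forallb => i; rewrite eq_sym. Qed.

(** Here [0 < k] matters: without coordinates disjointness holds vacuously. *)
Lemma vdisjoint_irrefl x : vdisjoint x x = false.
Proof. by apply/negP => /forallP /(_ (Ordinal k_gt0)); rewrite eqxx. Qed.

Lemma extensions_notin C x : x \in extensions C -> x \notin C.
Proof.
rewrite inE => /forall_inP extCx; apply/negP => /extCx.
by rewrite vdisjoint_irrefl.
Qed.

Lemma is_matchingU1 C x :
  is_matching C -> x \in extensions C -> is_matching (x |: C).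
Proof.
move=> /is_matchingP mC; rewrite inE => /forall_inP extCx.
apply/is_matchingP => y z /setU1P[->|Cy] /setU1P[->|Cz]; rewrite ?eqxx //.
- by move=> _; apply: extCx.
- by move=> _; rewrite vdisjointC; apply: extCx.
exact: mC.
Qed.

Lemma mem_extensions M C x : is_matching M -> C \subset M ->
  x \in M -> x \notin C -> x \in extensions C.
Proof.
move=> /is_matchingP mM /subsetP sCM Mx nCx; rewrite inE; apply/forall_inP.
by move=> y Cy; apply: (mM _ _ Mx (sCM _ Cy)); apply: contraNneq nCx => ->.
Qed.

(** The coordinates are chosen independently. In coordinate [i] the edges of a matching take
    pairwise distinct values, so exactly [#|C|] values are forbidden. *)
Lemma card_extensions C : is_matching C ->
  #|extensions C| = \prod_(i < k) (n i - #|C|).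
Proof.
move=> /is_matchingP mC.
pose A (i : 'I_k) : {set 'I_(n i)} := ~: [set (y : edge n) i | y in C].
have -> : extensions C = [set x : edge n in family A].
  apply/setP => x; rewrite !inE; apply/forall_inP/familyP => [ext i|fam y Cy].
    rewrite inE; apply/negP => /imsetP[y Cy xy].
    by move/forallP: (ext y Cy) => /(_ i); rewrite xy eqxx.
  apply/forallP => i; have := fam i; rewrite inE.
  by apply: contraNneq => ->; apply: imset_f.
rewrite cardsE card_family foldrE big_map big_enum; apply: eq_bigr => i _ /=.
rewrite cardsCs setCK card_ord card_in_imset // => y z Cy Cz yz.
apply/eqP; apply: contraT => /(mC _ _ Cy Cz)/forallP/(_ i).
by rewrite yz eqxx.
Qed.

(** * The size of a star of matchings of fixed size *)

Lemma mem_star r C M :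
  (M \in star r C) = [&& is_matching M, #|M| == r & C \subset M].
Proof. by rewrite !inE -andbA. Qed.

(* Double count the pairs (M, x) with C |: x contained in M. *)
Lemma card_starS r C : is_matching C ->
  #|star r C| * (r - #|C|) = \sum_(x in extensions C) #|star r (x |: C)|.
Proof.
move=> mC.
have card1 x : x \in extensions C ->
    #|star r (x |: C)| = \sum_(M in star r C) (x \in M).
  move=> _; rewrite -big_mkcondr sum1dep_card; apply: eq_card => M.
  by rewrite [in RHS]inE !mem_star subUset sub1set; case: (x \in M);
    rewrite ?andbT ?andbF.
rewrite (eq_bigr _ card1) exchange_big /= -sum_nat_const; apply: eq_bigr => M.
rewrite mem_star => /and3P[mM /eqP <- sCM].
(* For fixed [M], the extension edges of [C] lying in [M] are exactly those of [M :\: C]. *)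
rewrite -cardsDS // -big_mkcondr /= sum1dep_card; apply: eq_card => x.
rewrite !inE; apply/andP/andP => [[nCx Mx]|[extx ->]].
  by split=> //; have := mem_extensions mM sCM Mx nCx; rewrite inE.
by split=> //; apply: extensions_notin; rewrite inE.
Qed.

(** Both sides count the ways of adding [d] edges to [C] one at a time; the factorial accounts for
    the order. The induction peels off the first added edge, hence [C] varies. *)
Lemma card_star d C : is_matching C ->
  #|star (#|C| + d) C| * d`! = \prod_(i < k) (n i - #|C|) ^_ d.
Proof.
elim: d C => [|d IHd] C mC.
  rewrite addn0 big1 // muln1; apply/eqP/cards1P; exists C.
  apply/setP => M; rewrite mem_star in_set1; apply/and3P/eqP => [[_ cM sCM]|->].
    by apply/esym/eqP; rewrite eqEcard sCM (eqP cM) /=.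
  by split.
(* The factor [d.+1] of the factorial is rewritten as the multiplicity [#|C| + d.+1 - #|C|] of the
   double count. *)
rewrite factS mulnA -[X in _ * X * _](addKn #|C|) card_starS // big_distrl /=.
rewrite (eq_bigr (fun=> \prod_(i < k) (n i - #|C|.+1) ^_ d)).
  rewrite sum_nat_const card_extensions // -big_split /=; apply: eq_bigr => i _.
  by rewrite ffactnS subnS.
move=> x extx; have cx : #|x |: C| = #|C|.+1.
  by rewrite cardsU1 extensions_notin.
by rewrite -cx -IHd ?is_matchingU1 // cx addSnnS.
Qed.

Lemma star_eq0 r C : r < #|C| -> star r C = set0.
Proof.
move=> ltrC; apply/setP => M; rewrite mem_star in_set0; apply/negP.
by case/and3P=> _ /eqP cM /subset_leq_card; rewrite cM leqNgt ltrC.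
Qed.

(** * Stars over a set [R] of sizes and the closed formula *)

Lemma mem_matchings_in R M :
  (M \in matchings_in n R) = is_matching M && (#|M| \in R).
Proof.
rewrite /matchings_in; have -> : (#|M| \in R) = (#|M| \in (R : seq nat)) by [].
elim: (R : seq nat) => [|r s IHs]; first by rewrite big_nil !inE andbF.
by rewrite big_cons in_setU IHs !inE -andb_orr.
Qed.

(** A matching has only one size and [R] lists it without repetition, so each member is counted
    once. *)
Lemma card_star_in R C : #|star_in R C| = \sum_(r <- R) #|star r C|.
Proof.
transitivity (\sum_(r <- R) \sum_(M in star_in R C) (#|M| == r)).
  rewrite exchange_big /= -sum1_card; apply: eq_bigr => M.
  rewrite inE mem_matchings_in -andbA => /and3P[_ RM _].
  by rewrite (big_rem _ RM) /= eqxx big_seq big1 // => r;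
    rewrite mem_rem_uniq ?fset_uniq // inE eq_sym => /andP[/negPf ->].
rewrite big_seq [RHS]big_seq; apply: eq_bigr => r Rr.
rewrite -big_mkcondr sum1dep_card /= ; apply: eq_card => M.
rewrite !inE mem_matchings_in; case: eqP => [->|]; rewrite ?andbF //= Rr.
by rewrite !andbT.
Qed.

(** Dividing [card_star] by the factorial yields each summand. In particular all [t]-stars have the
    same size, whatever their centre. *)
Lemma star_sizeE t R C : is_matching C -> #|C| = t ->
  (forall r, r \in R -> t <= r) -> star_size n t R = (#|star_in R C|%:R)%R.
Proof.
move=> mC cC leR; rewrite card_star_in natr_sum.
rewrite /star_size big_seq [RHS]big_seq; apply: eq_bigr => r Rr.
have := card_star (r - t) mC; rewrite cC subnKC ?leR // => e.
rewrite -natr_prod -e natrM mulfK //.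
by rewrite pnatr_eq0 -lt0n fact_gt0.
Qed.

(** Since [r <= n i], no falling factorial vanishes. Positivity keeps the empty family from
    attaining equality and makes the final estimate strict. *)
Lemma star_size_gt0 t R : R != fset0 ->
  (forall r, r \in R -> t <= r) ->
  (forall i r, r \in R -> r <= n i) -> (0 < star_size n t R)%R.
Proof.
case/fset0Pn => r0 Rr0 leR len.
have term_gt0 r : r \in R ->
    (0 < (\prod_(i < k) ((n i - t) ^_ (r - t))%:R) / ((r - t)`!)%:R :> rat)%R.
  move=> Rr; rewrite divr_gt0 ?ltr0n ?fact_gt0 // -natr_prod ltr0n.
  by rewrite prodn_gt0 // => i; rewrite ffact_gt0 leq_sub2r ?len.
rewrite /star_size (big_rem r0) //= ltr_wpDr ?term_gt0 // big_seq.
by apply: sumr_ge0 => r /mem_rem /term_gt0 /ltW.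
Qed.

(** * Enlarging the centre by one edge, and families without [t] common edges *)

Lemma card_starS_leq m r C C' (j : 'I_k) :
  is_matching C -> is_matching C' -> #|C'| = #|C|.+1 ->
  r <= m -> (forall i, r <= n i) ->
  #|star r C'| * (n j - #|C|) <= m * #|star r C|.
Proof.
move=> mC mC' cC' lerm len.
have [ltrC|leCr] := ltnP r #|C'|; first by rewrite star_eq0 // cards0.
have := card_star (r - #|C'|) mC'; rewrite subnKC // cC'.
set d := r - _ => e'.
have rE : r = #|C| + d.+1 by rewrite addnS -addSn subnKC // -cC'.
have := card_star d.+1 mC; rewrite -rE => e.
(* Exact ratio of the two sizes, from the formulas for both stars; only the cardinalities of the
   centres matter. *)
have {e} e : #|star r C'| * \prod_(i < k) (n i - #|C|) = #|star r C| * d.+1.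
  apply/eqP; rewrite -(eqn_pmul2r (fact_gt0 d)); apply/eqP.
  rewrite -[RHS]mulnA -factS e mulnAC e' -big_split /=.
  by apply: eq_bigr => i _; rewrite ffactnS subnS mulnC.
(* Only the factor at [j] is kept; the others are at least 1 because [#|C| < #|C'| <= r <= n i]. *)
apply: (@leq_trans (#|star r C'| * \prod_(i < k) (n i - #|C|))).
  rewrite leq_mul2l (bigD1 j) //= leq_pmulr ?orbT // prodn_cond_gt0 // => i _.
  by rewrite subn_gt0 -cC' (leq_trans leCr).
rewrite e mulnC leq_mul2r (leq_trans _ lerm) ?orbT // rE.
by rewrite leq_addl.
Qed.

Lemma card_star_inS_leq m R C x (j : 'I_k) :
  is_matching C -> x \notin C ->
  (forall r, r \in R -> r <= m) -> (forall i r, r \in R -> r <= n i) ->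
  #|star_in R (x |: C)| * (n j - #|C|) <= m * #|star_in R C|.
Proof.
move=> mC nCx lem len; have [mxC|nmxC] := boolP (is_matching (x |: C)).
  rewrite !card_star_in big_distrl big_distrr /= big_seq [X in _ <= X]big_seq.
  apply: leq_sum => r Rr; apply: card_starS_leq; rewrite ?cardsU1 ?nCx ?lem //.
  by move=> i; apply: len.
(* Subsets of matchings are matchings, so no member contains [x |: C]. *)
suff -> : star_in R (x |: C) = set0 by rewrite cards0.
apply/setP => M; rewrite !inE mem_matchings_in; apply/negP.
by case/andP=> /andP[mM _] /is_matchingS /(_ mM); apply/negP.
Qed.

(** If [M :&: N] lay inside [C], it would equal [C] by cardinality and force [C \subset N]. So [M]
    and [N] share an edge outside [C]. *)
Lemma subset_bigcup_star_in t R F C N :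
  F \subset matchings_in n R -> t_intersecting t F -> #|C| = t ->
  N \in F -> ~~ (C \subset N) ->
  [set M in F | C \subset M] \subset
    \bigcup_(x in N :\: C) star_in R (x |: C).
Proof.
move=> /subsetP sF tF cC FN nCN; apply/subsetP => M; rewrite inE.
case/andP=> FM sCM; have : ~~ (M :&: N \subset C).
  apply: contra nCN => sC; have sMN : M :&: N == C.
    by rewrite eqEcard sC cC tF.
  by rewrite -(eqP sMN) subsetIr.
case/subsetPn => x; rewrite inE => /andP[Mx Nx] nCx.
apply/bigcupP; exists x; first by rewrite inE nCx.
by rewrite inE sF // subUset sub1set Mx.
Qed.

(** The constant collects at most [2 ^ m] sets [C] inside a member [M0], at most [m] edges of [N]
    outside [C], and the factor [m] lost in comparing the enlarged stars with [t]-stars of size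
    [S]. *)
Lemma nontrivial_t_intersecting_bound m t R F S (j : 'I_k) :
  F \subset matchings_in n R -> t_intersecting t F -> F != set0 ->
  (forall C, #|C| = t -> exists2 N, N \in F & ~~ (C \subset N)) ->
  (forall C, is_matching C -> #|C| = t -> #|star_in R C| = S) ->
  (forall r, r \in R -> r <= m) -> (forall i r, r \in R -> r <= n i) ->
  #|F| * (n j - t) <= 2 ^ m * m * m * S.
Proof.
move=> sF tF /set0Pn[M0 FM0] nontriv cS lem len.
have card_le M : M \in F -> #|M| <= m.
  by move/(subsetP sF); rewrite mem_matchings_in => /andP[_ /lem].
have mM0 : is_matching M0.
  by move/(subsetP sF): FM0; rewrite mem_matchings_in => /andP[].
pose G := [set C : {set edge n} | C \subset M0 & #|C| == t].
have sFG : F \subset \bigcup_(C in G) [set M in F | C \subset M].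
  apply/subsetP => M FM; have : t <= #|M0 :&: M| by apply: tF.
  (* Any [t] edges shared by [M0] and [M] serve as [C]. *)
  case/card_geqP => s [us cs sM]; apply/bigcupP; exists [set x in s].
    rewrite inE cardsE (card_uniqP us) cs eqxx andbT.
    by apply/subsetP => x; rewrite inE => /sM; rewrite inE => /andP[].
  rewrite inE FM; apply/subsetP => x; rewrite inE => /sM.
  by rewrite inE => /andP[].
have bound C : C \in G ->
    #|[set M in F | C \subset M]| * (n j - t) <= m * m * S.
  rewrite inE => /andP[sCM0 /eqP cC]; have [N FN nCN] := nontriv C cC.
  have mC := is_matchingS sCM0 mM0.
  apply: (@leq_trans (\sum_(x in N :\: C) m * S)).
    rewrite (leq_trans (leq_mul (subset_leq_card
      (subset_bigcup_star_in sF tF cC FN nCN)) (leqnn _))) //.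
    rewrite (leq_trans (leq_mul (leq_card_bigcup _ _) (leqnn _))) //.
    rewrite big_distrl leq_sum //= => x; rewrite inE => /andP[nCx _].
    by rewrite -(cS C) // -cC card_star_inS_leq.
  rewrite sum_nat_const -mulnA leq_mul2r (leq_trans _ (card_le N FN)) ?orbT //.
  by rewrite subset_leq_card ?subsetDl.
rewrite (leq_trans (leq_mul (subset_leq_card sFG) (leqnn _))) //.
rewrite (leq_trans (leq_mul (leq_card_bigcup _ _) (leqnn _))) //.
rewrite big_distrl (leq_trans (leq_sum _ bound)) //= sum_nat_const.
(* The [t]-subsets of [M0] are bounded by all its subsets. *)
rewrite -!mulnA leq_mul2r (leq_trans (_ : _ <= #|powerset M0|)) ?orbT //.
  by apply/subset_leq_card/subsetP => C; rewrite !inE => /andP[].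
by rewrite card_powerset leq_pexp2l ?card_le.
Qed.

End Star.

(** * The threshold [n0] and the split by whether all members share [t] edges *)

Theorem theorem3p5 :
  forall m : nat, 0 < m ->
  exists n0 : nat,
  forall (k : nat) (hk : 1 < k) (t : nat) (n : 'I_k -> nat) (R : {fset nat})
    (n_1 := n (Ordinal (ltnW hk : 0 < k))) (n_2 := n (Ordinal hk)),
  0 < t ->
  0 < n_1 ->
  (forall i j : 'I_k, i <= j -> n i <= n j) ->
  R != fset0 ->
  (forall r, r \in R -> 0 < r <= n_1) ->
  (forall r, r \in R -> t <= r) ->
  \max_(r <- R) r = m ->
  n0 <= n_2 ->
  forall F : {set {set edge n}},
  F \subset matchings_in n R ->
  t_intersecting t F ->
  (#|F|%:R <= star_size n t R)%R /\
  ((#|F|%:R)%R = star_size n t R <-> t_star t R F).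
Proof.
(* As [t <= m], this makes [n_2 - t] exceed the constant [2 ^ m * m * m] of the nontrivial case. *)
move=> m _; exists (2 ^ m * m * m + m).+1 => k hk t n R n_1 n_2.
move=> _ _ n_mono R_n0 R_n1 R_t R_m le_n2 F sF tF.
have k_gt0 := ltnW hk.
have R_le_m r : r \in R -> r <= m.
  by move=> Rr; rewrite -R_m; apply: leq_bigmax_seq.
have R_le_n i r : r \in R -> r <= n i.
  by case/R_n1/andP=> _ /leq_trans; apply; apply: n_mono.
have S_gt0 := star_size_gt0 R_n0 R_t R_le_n.
have star_card (G : {set {set edge n}}) : t_star t R G -> (#|G|%:R = star_size n t R)%R.
  case=> C; rewrite inE => /andP[mC /eqP cC] ->.
  by rewrite (star_sizeE k_gt0 mC cC).
(* Every [t]-star attains the bound, so under strict inequality both sides of the equivalence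
   fail. *)
have strict : (#|F|%:R < star_size n t R)%R ->
    (#|F|%:R <= star_size n t R)%R /\
    ((#|F|%:R)%R = star_size n t R <-> t_star t R F).
  move=> lt; split; first exact: ltW.
  by split=> [e|/star_card e]; move: lt; rewrite e ltxx.
have [F0|/[dup] F_n0 /set0Pn[M0 FM0]] := eqVneq F set0.
  by apply: strict; rewrite F0 cards0.
(* A reference centre, cut out of a member of [F], turns the rational bound into a cardinality. *)
have [C0 mC0 cC0] : exists2 C0 : {set edge n}, is_matching C0 & #|C0| = t.
  have /andP[mM0 RM0] : is_matching M0 && (#|M0| \in R).
    by rewrite -mem_matchings_in (subsetP sF).
  have /card_geqP[s [us cs sM]] := R_t _ RM0.
  exists [set x in s]; last by rewrite cardsE (card_uniqP us).
  by apply: is_matchingS mM0; apply/subsetP => x; rewrite inE => /sM.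
have [|nontriv] := boolP [exists C : {set edge n},
  (#|C| == t) && [forall N in F, C \subset N]].
  case/existsP=> C /andP[/eqP cC /forall_inP sCF].
  have mC : is_matching C.
    apply: is_matchingS (sCF _ FM0) _.
    by move/(subsetP sF): FM0; rewrite mem_matchings_in => /andP[].
  (* The trivial case: [F] lies in the star of [C], so equal cardinalities force equality of the
     families. *)
  have sFC : F \subset star_in R C.
    by apply/subsetP => M FM; rewrite inE (subsetP sF) // sCF.
  rewrite (star_sizeE k_gt0 mC cC R_t) ler_nat subset_leq_card //.
  split=> //; split=> [/eqP|/star_card ->]; last exact: star_sizeE.
  rewrite eqr_nat => /eqP e; exists C; first by rewrite inE mC cC eqxx.
  by apply/eqP; rewrite eqEcard sFC e leqnn.
(* The second coordinate is used because [n_2] is large by assumption, while [n_1] may be as small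
   as [m]. *)
have F_le : #|F| * (n_2 - t) <= 2 ^ m * m * m * #|star_in R C0|.
  apply: (nontrivial_t_intersecting_bound k_gt0 (Ordinal hk) sF tF) => //.
    move=> C cC; move: nontriv; rewrite negb_exists => /forallP/(_ C).
    rewrite cC eqxx /= negb_forall => /existsP[N].
    by rewrite negb_imply => /andP[]; exists N.
  move=> C mC cC; apply/eqP; rewrite -(eqr_nat rat).
  by rewrite -(star_sizeE k_gt0 mC cC R_t) (star_sizeE k_gt0 mC0 cC0 R_t).
apply: strict; move: S_gt0; rewrite (star_sizeE k_gt0 mC0 cC0 R_t) ltr0n ltr_nat.
move=> S_gt0; have t_le_m : t <= m.
  by case/fset0Pn: R_n0 => r Rr; apply: leq_trans (R_t r Rr) (R_le_m r Rr).
have lt_n2 : 2 ^ m * m * m < n_2 - t.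
  by rewrite ltn_subRL addnC (leq_trans _ le_n2) // ltnS leq_add2l.
rewrite -(ltn_pmul2r (leq_ltn_trans (leq0n _) lt_n2)) (leq_ltn_trans F_le) //.
by rewrite mulnC ltn_pmul2l.
Qed.
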